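(* Let $G=(V,E)$ be a finite undirected weighted graph with $V=\{1,\dots,n\}$ and all degrees $d_i>0$, let $d\ge1$, and let $\rho:E\to O(d)$ be given with $\rho_{ji}=\rho_{ij}^{-1}$. Let $z\in\mathbb{R}^{dn}$ be an eigenvector of the normalized graph Connection Laplacian $\mathcal{L}_1$ for its smallest eigenvalue $\lambda_1(\mathcal{L}_1)$, and let $x=D_1^{-1/2}z$. For each vertex $i$ let $u_i=\|x_i\|^2$ and $v^i=x^{u_i}:V\to\mathbb{S}^{d-1}\cup\{0\}$, and let $v$ be one of $v^1,\dots,v^n$ with minimal value of $\eta$. Then $$\eta(v)\le\sqrt{10\,\lambda_1(\mathcal{L}_1)}.$$ If $d=1$, then moreover $\eta(v)\le\sqrt{8\,\lambda_1(\mathcal{L}_1)}$.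
   Context: $G$ is a simple graph with symmetric weights $w_{ij}=w_{ji}$, $w_{ij}>0$ if $(i,j)\in E$ and $w_{ij}=0$ otherwise; $d_i=\sum_j w_{ij}$. $O(d)$ is the group of $d\times d$ real orthogonal matrices; $\mathbb{S}^{d-1}$ is the unit sphere in $\mathbb{R}^d$. Sums $\sum_{i,j}$ run over all ordered pairs of vertices (terms with $w_{ij}=0$ vanish). For $x\in\mathbb{R}^{dn}$, $x_i\in\mathbb{R}^d$ denotes its $i$-th $d\times1$ block, and $x$ is identified with the function $i\mapsto x_i$. For $u>0$, $x^u$ is defined by $x^u_i=x_i/\|x_i\|$ if $\|x_i\|^2\ge u$ and $x^u_i=0$ if $\|x_i\|^2<u$. For $u=0$, $x^0$ is defined by $x^0_i=x_i/\|x_i\|$ if $x_i\ne0$ and $x^0_i=0$ if $x_i=0$. $W_1\in\mathbb{R}^{dn\times dn}$ is the symmetric matrix whose $(i,j)$-th $d\times d$ block is $w_{ij}\rho_{ij}$, $D_1\in\mathbb{R}^{dn\times dn}$ is block diagonal with $i$-th diagonal block $d_iI_{d\times d}$, and $\mathcal{L}_1=I-D_1^{-1/2}W_1D_1^{-1/2}$. For $v:V\to\mathbb{R}^d$ not identically zero, $$\eta(v)=\frac12\,\frac{\sum_{i,j}w_{ij}\|v_i-\rho_{ij}v_j\|^2}{\sum_i d_i\|v_i\|^2}.$$ *)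

(* Defs.v *)
From HB Require Import structures.
From mathcomp Require Import all_boot all_order all_algebra.
From mathcomp Require Import reals.
Set Implicit Arguments.
Unset Strict Implicit.
Unset Printing Implicit Defensive.
Import Order.TTheory GRing.Theory Num.Theory.
Local Open Scope ring_scope.

Section Euclidean.
Variables (R : realType) (d : nat).
Implicit Types (a : 'cV[R]_d) (Q : 'M[R]_d).

(* The canonical norm [`| a |] that MathComp-Analysis puts on matrices is the
   sup norm, hence these Euclidean versions. *)
Definition sqnorm a : R := \sum_(k < d) a k 0 ^+ 2.
Definition enorm a : R := Num.sqrt (sqnorm a).

Definition orthogonal_mx Q : Prop := Q^T *m Q = 1%:M.

End Euclidean.

(* [e] is the edge relation and [w] the weights, extended by 0 off the edges. *)
Definition weighted_graph (R : realType) (n : nat)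
    (e : rel 'I_n) (w : 'I_n -> 'I_n -> R) : Prop :=
  [/\ symmetric e, irreflexive e,
      forall i j, w i j = w j i,
      forall i j, e i j -> 0 < w i j
    & forall i j, ~~ e i j -> w i j = 0].

(* [rho] is a map from the edges to O(d).  It is encoded as a total function;
   its values off the edges are unconstrained, and every use of [rho i j] below
   is multiplied by [w i j]. *)
Definition connection (R : realType) (n d : nat)
    (e : rel 'I_n) (rho : 'I_n -> 'I_n -> 'M[R]_d) : Prop :=
  forall i j, e i j ->
    orthogonal_mx (rho i j) /\ rho j i = invmx (rho i j).

Section ConnectionLaplacian.
Variables (R : realType) (n d : nat).
Variables (w : 'I_n -> 'I_n -> R) (rho : 'I_n -> 'I_n -> 'M[R]_d).

Definition degree (i : 'I_n) : R := \sum_(j < n) w i j.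

(* The dimension dn is written as the sum of the n block sizes, all equal to d,
   so that the library's block matrices apply. *)
Definition W1 : 'M[R]_(\sum_(i < n) d) :=
  \mxblock_(i < n, j < n) (w i j *: rho i j).

Definition D1 : 'M[R]_(\sum_(i < n) d) :=
  \mxdiag_(i < n) ((degree i)%:M : 'M[R]_d).

Definition D1_invsqrt : 'M[R]_(\sum_(i < n) d) :=
  \mxdiag_(i < n) ((Num.sqrt (degree i))^-1%:M : 'M[R]_d).

Lemma D1_invsqrtP :
  (forall i, 0 < degree i) -> D1_invsqrt *m D1_invsqrt *m D1 = 1%:M.
Proof.
move=> degP; rewrite /D1_invsqrt /D1 !mul_mxdiag_mxblock !mul_mxblock_mxdiag.
rewrite -(mxdiagZ 1); apply/eq_mxblock => i j.
have [<-|_] := eqVneq; last by rewrite mulmx0 mul0mx.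
rewrite !conform_mx_id -!scalar_mxM; congr (_%:M).
by rewrite -invfM -expr2 sqr_sqrtr ?ltW // mulVf ?gt_eqF.
Qed.

Definition L1 : 'M[R]_(\sum_(i < n) d) :=
  1%:M - D1_invsqrt *m W1 *m D1_invsqrt.

(* Meaningful for [v] not identically zero; the quotient is 0 otherwise. *)
Definition eta (v : 'I_n -> 'cV[R]_d) : R :=
  2^-1 * ((\sum_(i < n) \sum_(j < n) w i j * enorm (v i - rho i j *m v j) ^+ 2)
          / (\sum_(i < n) degree i * enorm (v i) ^+ 2)).

End ConnectionLaplacian.

Section Rounding.
Variables (R : realType) (n d : nat).

(* the block x_i of x *)
Definition block (x : 'cV[R]_(\sum_(i < n) d)) (i : 'I_n) : 'cV[R]_d :=
  submxcol x i.

(* x^u, for u >= 0 *)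
Definition threshold (x : 'cV[R]_(\sum_(i < n) d)) (u : R) (i : 'I_n) :
    'cV[R]_d :=
  let xi := block x i in
  if (if u == 0 then xi != 0 else u <= enorm xi ^+ 2)
  then (enorm xi)^-1 *: xi else 0.

End Rounding.

Definition smallest_eigenvalue (R : realType) (m : nat) (A : 'M[R]_m) (a : R) :
    Prop :=
  eigenvalue A a /\ forall b, eigenvalue A b -> a <= b.

(* The library's eigenvectors are row vectors; here [z] is a column. *)
Definition eigenvector (R : realType) (m : nat) (A : 'M[R]_m) (a : R)
    (z : 'cV[R]_m) : Prop :=
  z != 0 /\ A *m z = a *: z.

(* Main.v *)
(* Draw the level u uniformly from [0, max |x_i|^2].  Up to a common factor,
   |x^u_i|^2 has expectation |x_i|^2, and |x^u_i - rho_ij x^u_j|^2 has expectation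
   F_ij = a^2 + b^2 - 2 min(a^2,b^2) p, where a = |x_i|, b = |x_j| and p is the
   cosine of the angle between x_i and rho_ij x_j.  As
   F_ij <= (a + b) |x_i - rho_ij x_j|, the Cauchy-Schwarz inequality bounds the
   ratio of the expectations, hence some eta (x^u), by sqrt (2 lambda), which is
   better than required.  Only the levels u_i matter, so the expectations are
   finite sums. *)
Require Import Defs.
From mathcomp Require Import all_boot all_order all_algebra.
From mathcomp Require Import reals.
From mathcomp Require Import ring lra.
Set Implicit Arguments.
Unset Strict Implicit.
Unset Printing Implicit Defensive.
Import Order.TTheory GRing.Theory Num.Theory.
Local Open Scope ring_scope.

(** * Layer-cake decomposition over finitely many levels *)

Section LevelWeights.
Variables (R : realFieldType) (I : finType) (u : I -> R).
Hypothesis u_ge0 : forall i, 0 <= u i.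

(* The weight of j is the gap between u j and the preceding value of u, given to
   one of the indices sharing that value. *)
Lemma level_weights_in (A : {set I}) : exists c : I -> R,
  (forall j, 0 <= c j) /\
  (forall i, i \in A -> \sum_(j in A | u j <= u i) c j = u i).
Proof.
have [m] := ubnP #|A|; elim: m A => // m IHm A.
have [->|[m0 m0A]] := set_0Vmem A.
  by move=> _; exists (fun=> 0); split=> // i; rewrite inE.
case: (Order.TotalTheory.arg_maxP u m0A) => t tA t_max leAm.
have {}tA : t \in A := tA.
have {}t_max j : j \in A -> u j <= u t := t_max j.
have [c' [c'_ge0 c'P]] : exists c : I -> R, (forall j, 0 <= c j) /\
    (forall i, i \in A :\ t -> \sum_(j in A :\ t | u j <= u i) c j = u i).
  by apply: IHm; move: leAm; rewrite (cardsD1 t) tA.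
(* By [s_top], [s] is the largest value of [u] on [A :\ t], or 0 if that set is empty, so the
   maximiser [t] receives the gap [u t - s]. *)
pose s := \sum_(j in A :\ t) c' j.
have s_top i : i \in A :\ t -> (forall j, j \in A :\ t -> u j <= u i) -> s = u i.
  move=> iA i_max; rewrite -(c'P i iA) /s; apply: eq_bigl => j.
  by case: (boolP (j \in A :\ t)) => //= /i_max.
have s_le : s <= u t.
  have [A'0|[i0 i0A]] := set_0Vmem (A :\ t).
    by rewrite /s A'0 big_set0.
  case: (Order.TotalTheory.arg_maxP u i0A) => i iA i_max.
  by rewrite (s_top i iA i_max); apply: t_max; case/setD1P: iA.
exists (fun j => if j == t then u t - s else c' j); split=> [j|i iA].
  by case: eqP => _ //; rewrite subr_ge0.
have sumD1 (P : pred I) :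
    \sum_(j in A | P j) (if j == t then u t - s else c' j)
    = (if P t then u t - s else 0) + \sum_(j in A :\ t | P j) c' j.
  rewrite big_mkcondr (big_setD1 t tA) /= eqxx [in RHS]big_mkcondr.
  by congr (_ + _); apply: eq_bigr => j /setD1P[/negPf-> _].
rewrite sumD1; have [->|neq_it] := eqVneq i t.
  rewrite lexx (_ : \sum_(j in _ | _) _ = s) ?subrK //; apply: eq_bigl => j.
  by case: (boolP (j \in A :\ t)) => //= /setD1P[_ /t_max].
have iA' : i \in A :\ t by rewrite in_setD1 neq_it.
rewrite c'P //; case: ifP => [le_ti|]; last by rewrite add0r.
(* A tie with [t] forces [s = u t], so the extra term [u t - s] vanishes. *)
have eq_ti : u i = u t by apply/le_anti; rewrite le_ti t_max.
by rewrite (s_top i) // ?eq_ti ?subrr ?add0r // => j /setD1P[_ /t_max].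
Qed.

(** As t grows from 0, the indicator of t <= [u i] changes only at a value of [u], so its integral
    [u i] is a finite sum with the gaps as weights. *)
Lemma level_weights : exists c : I -> R,
  (forall j, 0 <= c j) /\ (forall i, \sum_j c j * (u j <= u i)%R%:R = u i).
Proof.
have [c [c_ge0 cP]] := level_weights_in setT.
exists c; split=> // i; rewrite -[RHS](cP i (in_setT i)) big_mkcond /=.
rewrite [RHS]big_mkcond; apply: eq_bigr => j _; rewrite in_setT /=.
by case: ifP => _; rewrite ?mulr1 ?mulr0.
Qed.

End LevelWeights.

(** * Scalar inequalities *)

(** The squared form of F_ij <= (a + b) |x_i - rho_ij x_j|. For b <= a the difference of the sides
    factors, and its last factor is at least 2 (1 + p) b^3 >= 0. *)
Lemma rounding_gap_sqr (R : realFieldType) (a b p : R) :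
  0 <= a -> 0 <= b -> -1 <= p <= 1 ->
  (a ^+ 2 + b ^+ 2 - 2 * Num.min (a ^+ 2) (b ^+ 2) * p) ^+ 2
    <= (a + b) ^+ 2 * (a ^+ 2 + b ^+ 2 - 2 * (a * b * p)).
Proof.
wlog le_ba : a b / b <= a.
  move=> wlog_ba a0 b0 p1; have [le_ba|/ltW le_ab] := leP b a.
    exact: wlog_ba.
  have := wlog_ba b a le_ab b0 a0 p1.
  by rewrite minC [b + a]addrC [b * a]mulrC [b ^+ 2 + _]addrC.
move=> a0 b0 /andP[p_ge p_le].
have le_sqr : b ^+ 2 <= a ^+ 2 by rewrite ler_pXn2r.
rewrite min_r // -subr_ge0.
have -> : (a + b) ^+ 2 * (a ^+ 2 + b ^+ 2 - 2 * (a * b * p))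
   - (a ^+ 2 + b ^+ 2 - 2 * b ^+ 2 * p) ^+ 2
  = 2 * (1 - p) * (b * (a ^+ 3 + a * b ^+ 2 + 2 * p * b ^+ 3)) by ring.
rewrite mulr_ge0 ?mulr_ge0 ?subr_ge0 //.
have b3 : 0 <= b ^+ 3 by rewrite exprn_ge0.
have h1 : b ^+ 3 <= a ^+ 3 by rewrite ler_pXn2r ?nnegrE.
have h2 : b ^+ 3 <= a * b ^+ 2 by rewrite exprS ler_wpM2r ?exprn_ge0.
have h3 : 0 <= (1 + p) * b ^+ 3 by rewrite mulr_ge0 //; lra.
nra.
Qed.

(** Weighted AM-GM, from (t^2 h - g)^2 >= 0. Being linear in [g] and [h], the bound can be summed
    over edges; choosing [t] afterwards then does the work of Cauchy-Schwarz. *)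
Lemma le_AMGM_sqr (R : realFieldType) (t f g h : R) :
  0 < t -> 0 <= g -> 0 <= h -> f ^+ 2 <= g * h ->
  f <= t / 2 * h + g / (2 * t).
Proof.
move=> t0 g0 h0 fgh; have t2 : 0 < 2 * t by rewrite mulr_gt0.
rewrite -(ler_pM2l t2).
have -> : 2 * t * (t / 2 * h + g / (2 * t)) = t ^+ 2 * h + g.
  by field; rewrite gt_eqF.
have rhs0 : 0 <= t ^+ 2 * h + g := addr_ge0 (mulr_ge0 (sqr_ge0 t) h0) g0.
have [f0|/ltW f0] := leP f 0.
  by apply: le_trans rhs0; rewrite mulr_ge0_le0 // ltW.
have lhs0 : 0 <= 2 * t * f := mulr_ge0 (ltW t2) f0.
rewrite -ler_sqr ?nnegrE //.
apply: (@le_trans _ _ (4 * t ^+ 2 * (g * h))).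
  have -> : (2 * t * f) ^+ 2 = 4 * t ^+ 2 * f ^+ 2 by ring.
  by rewrite ler_wpM2l // mulr_ge0 // sqr_ge0.
rewrite -subr_ge0.
have -> : (t ^+ 2 * h + g) ^+ 2 - 4 * t ^+ 2 * (g * h) = (t ^+ 2 * h - g) ^+ 2.
  by ring.
exact: sqr_ge0.
Qed.

(** * Euclidean geometry of the blocks *)

Section Dot.
Variables (R : realType) (d : nat).
Implicit Types (a b : 'cV[R]_d) (Q : 'M[R]_d).

Definition dot a b : R := (a^T *m b) 0 0.

Lemma dotE a b : dot a b = \sum_(k < d) a k 0 * b k 0.
Proof. by rewrite /dot mxE; apply: eq_bigr => k _; rewrite mxE. Qed.

Lemma sqnormE a : sqnorm a = dot a a.
Proof. by rewrite dotE; apply: eq_bigr => k _; rewrite expr2. Qed.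

Lemma dotZ s t a b : dot (s *: a) (t *: b) = s * t * dot a b.
Proof.
by rewrite !dotE mulr_sumr; apply: eq_bigr => k _; rewrite !mxE mulrACA.
Qed.

Lemma dotZr s a b : dot a (s *: b) = s * dot a b.
Proof. by rewrite -[a in LHS]scale1r dotZ mul1r. Qed.

Lemma dotBr a b c : dot a (b - c) = dot a b - dot a c.
Proof. by rewrite /dot mulmxBr !mxE. Qed.

Lemma dot_sumr (I : finType) a (F : I -> 'cV[R]_d) :
  dot a (\sum_i F i) = \sum_i dot a (F i).
Proof. by rewrite /dot mulmx_sumr summxE. Qed.

Lemma sqnorm_ge0 a : 0 <= sqnorm a.
Proof. by apply: sumr_ge0 => k _; apply: sqr_ge0. Qed.

Lemma enorm_ge0 a : 0 <= enorm a.
Proof. exact: sqrtr_ge0. Qed.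

Lemma sqr_enorm a : enorm a ^+ 2 = sqnorm a.
Proof. by rewrite sqr_sqrtr ?sqnorm_ge0. Qed.

Lemma sqnorm_eq0 a : (sqnorm a == 0) = (a == 0).
Proof.
apply/eqP/eqP=> [a0|->]; last first.
  by rewrite sqnormE dotE big1 // => k _; rewrite mxE mul0r.
apply/colP => k; rewrite mxE; apply/eqP; rewrite -sqrf_eq0.
by have /psumr_eq0P/(_ a0)-> := fun (i : 'I_d) (_ : true) => sqr_ge0 (a i 0).
Qed.

Lemma enorm_eq0 a : (enorm a == 0) = (a == 0).
Proof. by rewrite -sqrf_eq0 sqr_enorm sqnorm_eq0. Qed.

Lemma sqnormB_scale s t a b : sqnorm (s *: a - t *: b)
  = s ^+ 2 * sqnorm a + t ^+ 2 * sqnorm b - 2 * (s * t * dot a b).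
Proof.
rewrite dotE !mulr_sumr -big_split -sumrB; apply: eq_bigr => k _ /=.
by rewrite !mxE; ring.
Qed.

Lemma sqnormB a b : sqnorm (a - b) = sqnorm a + sqnorm b - 2 * dot a b.
Proof. by have := sqnormB_scale 1 1 a b; rewrite !scale1r expr1n !mul1r. Qed.

Lemma sqnorm_orthogonal Q a : orthogonal_mx Q -> sqnorm (Q *m a) = sqnorm a.
Proof.
by move=> QQ; rewrite !sqnormE /dot trmx_mul -mulmxA (mulmxA Q^T) QQ mul1mx.
Qed.

(* The direction of 0 is 0. *)
Definition direction a : 'cV[R]_d := (enorm a)^-1 *: a.

Lemma direction_scale a : a = enorm a *: direction a.
Proof.
rewrite scalerA; have [->|a0] := eqVneq a 0; first by rewrite scaler0.
by rewrite divff ?scale1r // enorm_eq0.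
Qed.

Lemma sqnorm_direction a : sqnorm (direction a) = (a != 0)%:R.
Proof.
rewrite sqnormE dotZ -sqnormE -sqr_enorm -invfM -expr2.
have [->|a0] := eqVneq a 0; last by rewrite mulVf // sqrf_eq0 enorm_eq0.
by have /eqP-> : enorm (0 : 'cV[R]_d) == 0; rewrite ?enorm_eq0 // expr2 !mulr0.
Qed.

(** Expand |a - b|^2 >= 0 and |a + b|^2 >= 0. The hypotheses are inequalities because a direction
    may be 0. *)
Lemma dot_unit_bound a b : sqnorm a <= 1 -> sqnorm b <= 1 -> -1 <= dot a b <= 1.
Proof.
move=> a1 b1.
have := sqnorm_ge0 (1 *: a - 1 *: b); have := sqnorm_ge0 (1 *: a - (-1) *: b).
rewrite !sqnormB_scale sqrrN !expr1n !mul1r mulN1r => h1 h2.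
by apply/andP; split; lra.
Qed.

End Dot.

(** * Energy and eigenvectors of the connection Laplacian *)

Section Connection.
Variables (R : realType) (n d : nat).
Variables (e : rel 'I_n) (w : 'I_n -> 'I_n -> R) (rho : 'I_n -> 'I_n -> 'M[R]_d).
Hypotheses (hG : weighted_graph e w) (hdeg : forall i, 0 < degree w i).
Hypothesis hrho : connection e rho.

Lemma weight_sym i j : w i j = w j i.
Proof. by case: hG. Qed.

Lemma weight_ge0 i j : 0 <= w i j.
Proof.
case: hG => _ _ _ wpos w0.
by have [/wpos/ltW|/w0->] := boolP (e i j).
Qed.

(** Since [rho] is constrained only on edges, each term of a weighted double sum either vanishes or
    involves an isometry. *)
Lemma weighted_edge i j : w i j = 0 \/ orthogonal_mx (rho i j).
Proof.
case: hG => _ _ _ _ w0.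
by have [/hrho[]|/w0] := boolP (e i j); [right|left].
Qed.

Lemma sum_degree (f : 'I_n -> R) :
  \sum_i degree w i * f i = \sum_i \sum_j w i j * f i.
Proof. by apply: eq_bigr => i _; rewrite mulr_suml. Qed.

Lemma sum_weightD (f g : 'I_n -> R) : \sum_i \sum_j w i j * (f i + g j)
  = \sum_i degree w i * f i + \sum_i degree w i * g i.
Proof.
rewrite [X in _ = _ + X]sum_degree [in RHS]exchange_big sum_degree -big_split /=.
apply: eq_bigr => i _; rewrite -big_split /=; apply: eq_bigr => j _.
by rewrite mulrDr (weight_sym j i).
Qed.

(** Orthogonality turns |rho_ij x_j| into |x_j|, and symmetry of [w] merges the two square terms.
    The right-hand side is twice the quadratic form of D1 - W1. *)
Lemma energy_expand (x : 'I_n -> 'cV[R]_d) :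
  \sum_i \sum_j w i j * sqnorm (x i - rho i j *m x j)
  = 2 * (\sum_i degree w i * sqnorm (x i)
         - \sum_i \sum_j w i j * dot (x i) (rho i j *m x j)).
Proof.
rewrite mulrBr mulr_natl mulr2n -sum_weightD mulr_sumr -sumrB.
apply: eq_bigr => i _; rewrite mulr_sumr -sumrB; apply: eq_bigr => j _.
have [->|oij] := weighted_edge i j; first by rewrite !mul0r mulr0 subr0.
by rewrite sqnormB sqnorm_orthogonal //; ring.
Qed.

Lemma block_D1_invsqrt (z : 'cV[R]_(\sum_(i < n) d)) i :
  block (D1_invsqrt d w *m z) i = (Num.sqrt (degree w i))^-1 *: block z i.
Proof.
rewrite /block /D1_invsqrt -{1}[z]submxcolK mul_mxdiag_mxcol mxcolK.
by rewrite mul_scalar_mx.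
Qed.

Lemma block_W1 (z : 'cV[R]_(\sum_(i < n) d)) i :
  block (W1 w rho *m z) i = \sum_j w i j *: (rho i j *m block z j).
Proof.
rewrite /block /W1 -{1}[z]submxcolK mul_mxblock_mxrow mxcolK.
by apply: eq_bigr => j _; rewrite scalemxAl.
Qed.

Section Eigenvector.
Variables (lam : R) (z : 'cV[R]_(\sum_(i < n) d)).
Hypothesis hz : eigenvector (L1 w rho) lam z.
Let x i := block (D1_invsqrt d w *m z) i.

(** Multiplying L1 z = lam z by D1^(1/2) gives (D1 - W1) x = lam D1 x, read here in block [i]. *)
Lemma eigenvector_block i :
  degree w i *: x i - \sum_j w i j *: (rho i j *m x j)
  = (lam * degree w i) *: x i.
Proof.
case: hz => _ /(congr1 (fun y => Num.sqrt (degree w i) *: block y i)).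
have s0 : Num.sqrt (degree w i) != 0 by rewrite gt_eqF ?sqrtr_gt0.
have blockz : block z i = Num.sqrt (degree w i) *: x i.
  by rewrite /x block_D1_invsqrt scalerA divff ?scale1r.
rewrite /L1 mulmxBl mul1mx -!mulmxA.
have blockB (y1 y2 : 'cV[R]_(\sum_(i < n) d)) :
    block (y1 - y2) i = block y1 i - block y2 i.
  by apply/matrixP=> p q; rewrite !mxE.
have blockZ (s : R) (y : 'cV[R]_(\sum_(i < n) d)) :
    block (s *: y) i = s *: block y i.
  by apply/matrixP=> p q; rewrite !mxE.
rewrite blockB blockZ block_D1_invsqrt block_W1 blockz scalerBr !scalerA.
rewrite divff // scale1r -expr2 sqr_sqrtr ?ltW // => ->.
by rewrite [_ * lam]mulrC -mulrA -expr2 sqr_sqrtr ?ltW.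
Qed.

(** Pairing the block equations with [x]: before rounding, [eta] of [x] is [lam]. *)
Lemma eigenvector_energy :
  \sum_i \sum_j w i j * sqnorm (x i - rho i j *m x j)
  = 2 * (lam * \sum_i degree w i * sqnorm (x i)).
Proof.
rewrite energy_expand mulr_sumr -sumrB; congr (2 * _); apply: eq_bigr => i _.
have /(congr1 (dot (x i))) := eigenvector_block i.
rewrite dotBr !dotZr dot_sumr -sqnormE mulrA => <-.
by congr (_ - _); apply: eq_bigr => j _; rewrite dotZr.
Qed.

End Eigenvector.

(** * Thresholded vectors and their average over the levels *)

Section Rounding.
Variable x : 'cV[R]_(\sum_(i < n) d).
Let u i := enorm (block x i) ^+ 2.

(** The cosine p, with value 0 when either block vanishes. *)
Definition block_cos i j : R :=
  dot (direction (block x i)) (rho i j *m direction (block x j)).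

Lemma dot_block_cos i j : dot (block x i) (rho i j *m block x j)
  = enorm (block x i) * enorm (block x j) * block_cos i j.
Proof.
rewrite {1}[block x i]direction_scale {1}[block x j]direction_scale.
by rewrite -scalemxAr dotZ.
Qed.

Lemma block_cos_bound i j : orthogonal_mx (rho i j) -> -1 <= block_cos i j <= 1.
Proof.
move=> oij; apply: dot_unit_bound; rewrite ?sqnorm_orthogonal // sqnorm_direction.
  by case: eqP; rewrite ?ler01.
by case: eqP; rewrite ?ler01.
Qed.

(** At a positive level the special clause for level 0 is void, and t enters only through an
    indicator, which the level weights can average. *)
Lemma threshold_direction t i : 0 < t ->
  threshold x t i = (t <= u i)%R%:R *: direction (block x i).
Proof.
move=> t0; rewrite /threshold gt_eqF // -/(u i).
by case: ifP; rewrite ?scale1r ?scale0r.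
Qed.

Lemma sqr_enorm_threshold t i : 0 < t ->
  enorm (threshold x t i) ^+ 2 = (t <= u i)%R%:R.
Proof.
move=> t0; rewrite sqr_enorm threshold_direction // sqnormE dotZ -sqnormE.
rewrite sqnorm_direction -enorm_eq0 -sqrf_eq0.
case: (leP t (u i)) => [le_tu|_]; last by rewrite !mul0r.
by rewrite gt_eqF ?mulr1 // (lt_le_trans t0).
Qed.

(** The cross term survives only when both blocks pass the threshold, whence the minimum in F_ij. *)
Lemma sqr_enorm_threshold_gap t i j : 0 < t -> orthogonal_mx (rho i j) ->
  enorm (threshold x t i - rho i j *m threshold x t j) ^+ 2
  = (t <= u i)%R%:R + (t <= u j)%R%:R
    - 2 * block_cos i j * (t <= Num.min (u i) (u j))%R%:R.
Proof.
move=> t0 oij; rewrite sqr_enorm sqnormB sqnorm_orthogonal // -!sqr_enorm.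
rewrite !sqr_enorm_threshold // !threshold_direction // -scalemxAr dotZ.
rewrite -/(block_cos i j) le_min -mulnb natrM; ring.
Qed.

Lemma rounding_gap_AMGM tau i j : 0 < tau -> orthogonal_mx (rho i j) ->
  u i + u j - 2 * block_cos i j * Num.min (u i) (u j)
  <= tau / 2 * sqnorm (block x i - rho i j *m block x j)
     + (u i + u j) / tau.
Proof.
move=> tau0 oij.
set a := enorm (block x i); set b := enorm (block x j).
have a0 : 0 <= a := enorm_ge0 _; have b0 : 0 <= b := enorm_ge0 _.
have gap : sqnorm (block x i - rho i j *m block x j)
    = a ^+ 2 + b ^+ 2 - 2 * (a * b * block_cos i j).
  by rewrite sqnormB sqnorm_orthogonal // dot_block_cos -!sqr_enorm.
have := rounding_gap_sqr a0 b0 (block_cos_bound oij).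
rewrite -gap => /(le_AMGM_sqr tau0 (sqr_ge0 _) (sqnorm_ge0 _)).
rewrite -!/(u _) mulrAC => /le_trans; apply.
(* What remains is (a + b)^2 <= 2 (a^2 + b^2). *)
rewrite lerD2l invfM mulrA ler_pM2r ?invr_gt0 // ler_pdivrMr //.
rewrite -subr_ge0 (_ : _ - _ = (a - b) ^+ 2) ?sqr_ge0 //.
by rewrite /u -/a -/b; ring.
Qed.

Lemma degree_threshold_gt0 k : 0 < u k ->
  0 < \sum_i degree w i * enorm (threshold x (u k) i) ^+ 2.
Proof.
move=> uk0; rewrite (bigD1 k) //= sqr_enorm_threshold // lexx mulr1.
rewrite ltr_pwDl // sumr_ge0 // => i _.
by rewrite mulr_ge0 ?sqr_ge0 // ltW.
Qed.

(* The sum over the level weights of the inequalities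
   2 m * denominator <= numerator for the individual thresholds. *)
Lemma eta_lower_bound m :
  (forall i, 0 < u i -> m <= eta w rho (threshold x (u i))) ->
  2 * m * (\sum_i degree w i * u i) <= \sum_i \sum_j w i j *
     (u i + u j - 2 * block_cos i j * Num.min (u i) (u j)).
Proof.
move=> m_le; have u_ge0 i : 0 <= u i := sqr_ge0 _.
have [c [c_ge0 cP]] := level_weights u_ge0.
(* [cP] at [k] gives [c k <= u k], so a level 0, where [threshold] follows its other clause, carries
   no weight. *)
have c0 k : u k <= 0 -> c k = 0.
  move=> uk0; apply/eqP; rewrite eq_le c_ge0 andbT.
  apply: le_trans uk0; rewrite -[leRHS]cP (bigD1 k) //= lexx mulr1.
  by rewrite lerDl sumr_ge0 // => j _; rewrite mulr_ge0.
(* The minimum is itself a value of [u], so [cP] applies to it. *)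
have cmin i j : \sum_k c k * (u k <= Num.min (u i) (u j))%R%:R
    = Num.min (u i) (u j).
  by case: (leP (u i) (u j)) => _; rewrite cP.
pose num k := \sum_i \sum_j
  w i j * enorm (threshold x (u k) i - rho i j *m threshold x (u k) j) ^+ 2.
have le_num k : 0 < u k ->
    2 * m * \sum_i degree w i * (u k <= u i)%R%:R <= num k.
  move=> uk0; have := m_le k uk0; rewrite /eta -/(num k).
  rewrite [_^-1 * _]mulrC ler_pdivlMr // [m * 2]mulrC.
  rewrite ler_pdivlMr ?degree_threshold_gt0 //.
  by under eq_bigr do rewrite sqr_enorm_threshold //.
have -> : \sum_i degree w i * u i
    = \sum_k c k * \sum_i degree w i * (u k <= u i)%R%:R.
  under [RHS]eq_bigr do rewrite mulr_sumr.
  rewrite exchange_big; apply: eq_bigr => i _; rewrite -[u i in LHS]cP mulr_sumr.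
  by apply: eq_bigr => k _; rewrite mulrCA.
have -> : \sum_i \sum_j w i j *
     (u i + u j - 2 * block_cos i j * Num.min (u i) (u j)) = \sum_k c k * num k.
  rewrite /num; under [RHS]eq_bigr do rewrite mulr_sumr.
  rewrite [RHS]exchange_big; apply: eq_bigr => i _ /=.
  under [RHS]eq_bigr do rewrite mulr_sumr.
  rewrite [RHS]exchange_big; apply: eq_bigr => j _ /=.
  have [->|oij] := weighted_edge i j.
    by rewrite mul0r big1 // => k _; rewrite mul0r mulr0.
  rewrite -[X in X + _ - _]cP -[X in _ + X - _]cP -cmin.
  rewrite [2 * _ * _]mulr_sumr -big_split -sumrB mulr_sumr; apply: eq_bigr => k _ /=.
  have [uk0|/c0->] := ltP 0 (u k); last by rewrite !mul0r mulr0 addr0 subr0 mulr0.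
  by rewrite sqr_enorm_threshold_gap //; ring.
rewrite mulr_sumr ler_sum // => k _; rewrite mulrCA.
have [uk0|/c0->] := ltP 0 (u k); last by rewrite !mul0r.
by rewrite ler_wpM2l ?le_num.
Qed.

End Rounding.

(** * Comparison of the averages and conclusion *)

(** With D the degree-weighted square norm of [x], the averaged numerator is at least 2 m D by
    [eta_lower_bound] and at most (tau lam + 2 / tau) D by summing [rounding_gap_AMGM]. *)
Lemma eta_sqr_le_eigenvalue (lam : R) (z : 'cV[R]_(\sum_(i < n) d)) m :
  let x := D1_invsqrt d w *m z in
  eigenvector (L1 w rho) lam z ->
  (forall i, m <= eta w rho (threshold x (enorm (block x i) ^+ 2))) ->
  0 < m -> m ^+ 2 <= 2 * lam.
Proof.
move=> x hz m_le m0.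
have le_m := eta_lower_bound (fun i _ => m_le i).
pose D := \sum_i degree w i * enorm (block x i) ^+ 2.
have D_gt0 : 0 < D.
  have [k xk0] : exists k, block x k != 0.
    apply/existsP; rewrite -negb_forall; apply: contra (proj1 hz) => /forallP x0.
    rewrite -[z]submxcolK; apply/eqP; rewrite -[RHS]mxcol0.
    apply: eq_mxcol => i; move: (x0 i); rewrite block_D1_invsqrt scaler_eq0.
    by rewrite invr_eq0 gt_eqF ?sqrtr_gt0 //= => /eqP.
  have uk0 : 0 < enorm (block x k) ^+ 2 by rewrite exprn_even_gt0 //= enorm_eq0.
  rewrite /D (bigD1 k) //=; apply: ltr_pwDl; first exact: mulr_gt0.
  by rewrite sumr_ge0 // => i _; rewrite mulr_ge0 ?sqr_ge0 // ltW.
(* The minimiser of the bound tau * lam + 2 / tau in the extremal case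
   lam = m^2 / 2. *)
pose tau : R := 2 / m; have tau0 : 0 < tau by rewrite divr_gt0.
have : 2 * m * D <= tau / 2 * (2 * (lam * D)) + 2 * D / tau.
  apply: (le_trans le_m).
  have -> : 2 * (lam * D)
      = \sum_i \sum_j w i j * sqnorm (block x i - rho i j *m block x j).
    rewrite (eigenvector_energy hz); congr (2 * (_ * _)).
    by apply: eq_bigr => i _; rewrite sqr_enorm.
  have -> : 2 * D = \sum_i \sum_j
      w i j * (enorm (block x i) ^+ 2 + enorm (block x j) ^+ 2).
    by rewrite (sum_weightD (fun i => enorm (block x i) ^+ 2)) mulr_natl mulr2n.
  rewrite mulr_sumr mulr_suml -big_split ler_sum // => i _ /=.
  rewrite mulr_sumr mulr_suml -big_split ler_sum // => j _ /=.
  have [->|oij] := weighted_edge i j; first by rewrite !(mul0r, mulr0) addr0.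
  rewrite mulrCA -[w i j * _ / tau]mulrA -mulrDr ler_wpM2l ?weight_ge0 //.
  exact: rounding_gap_AMGM.
have -> : tau / 2 * (2 * (lam * D)) + 2 * D / tau = (2 * lam / m + m) * D.
  by rewrite /tau; field; rewrite gt_eqF.
rewrite ler_pM2r // => le_m2.
have : m <= 2 * lam / m by lra.
by rewrite ler_pdivlMr // expr2.
Qed.

End Connection.

Theorem mainTheorem5 (R : realType) (n d : nat) (d_ge1 : (1 <= d)%N)
    (e : rel 'I_n) (w : 'I_n -> 'I_n -> R) (rho : 'I_n -> 'I_n -> 'M[R]_d)
    (hG : weighted_graph e w)
    (hdeg : forall i : 'I_n, 0 < degree w i)
    (hrho : connection e rho)
    (lambda1 : R) (hlambda1 : smallest_eigenvalue (L1 w rho) lambda1)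
    (z : 'cV[R]_(\sum_(i < n) d)) (hz : eigenvector (L1 w rho) lambda1 z) :
  let x := D1_invsqrt d w *m z in
  let v_ (i : 'I_n) := threshold x (enorm (block x i) ^+ 2) in
  forall k : 'I_n,
    (forall i : 'I_n, eta w rho (v_ k) <= eta w rho (v_ i)) ->
    eta w rho (v_ k) <= Num.sqrt (10 * lambda1)
    /\ (d = 1%N -> eta w rho (v_ k) <= Num.sqrt (8 * lambda1)).
Proof.
move=> x v_ k k_min.
(* The constant 2 of [eta_sqr_le_eigenvalue] covers both 10 and 8. *)
have eta_sqrt (c : R) : 2 <= c -> eta w rho (v_ k) <= Num.sqrt (c * lambda1).
  move=> c2; have [eta0|eta_gt0] := leP (eta w rho (v_ k)) 0.
    exact: le_trans eta0 (sqrtr_ge0 _).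
  have eta2 := eta_sqr_le_eigenvalue hG hdeg hrho hz k_min eta_gt0.
  (* The sign of [lambda1] is read off from [eta2]. *)
  have lam0 : 0 <= lambda1.
    by rewrite -(pmulr_rge0 _ (ltr0n R 2)) (le_trans (sqr_ge0 _) eta2).
  rewrite -[leLHS]ger0_norm ?(ltW eta_gt0) // -sqrtr_sqr ler_wsqrtr //.
  by apply: le_trans eta2 _; rewrite ler_wpM2r.
by split=> [|_]; apply: eta_sqrt; rewrite ler_nat.
Qed.
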